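(* Let $S$ be a nonempty compact convex set in a locally convex (Hausdorff) space $E$ such that each $p\in \mathrm{ext}(S)$ is a limit point of $\mathrm{ext}(S)$ and $\{p\}$ is a split face of $S$. Then no nonzero subspace of $A(S)$ has property-$(wU)$ in $A(S)^{**}$.
   Context: $\mathrm{ext}(S)$ is the set of extreme points of $S$. A point $p$ is a limit point of $\mathrm{ext}(S)$ if every neighbourhood of $p$ contains a point of $\mathrm{ext}(S)\setminus\{p\}$. $A(S)$ is the Banach space of real-valued affine continuous functions on $S$ with the sup norm, viewed inside $A(S)^{**}$ via the canonical embedding. For a face $F$ of $S$, the complementary set $F'$ is the union of all faces of $S$ disjoint from $F$. A face $F$ is a split face if $F'$ is convex and every $s\in S\setminus(F\cup F')$ has a unique representation $s=\lambda p+(1-\lambda)q$ with $0<\lambda<1$, $p\in F$, $q\in F'$. A subspace $Y$ of a Banach space $X$ has property-$(wU)$ in $X$ if every bounded linear functional on $Y$ which attains its norm (on the closed unit ball of $Y$) has a unique norm-preserving linear extension to $X$. *)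

(* Defs.v *)
From HB Require Import structures.
From mathcomp Require Import all_boot all_order all_algebra.
From mathcomp Require Import all_classical all_reals all_analysis.

Set Implicit Arguments.
Unset Strict Implicit.
Unset Printing Implicit Defensive.

Import Order.TTheory GRing.Theory Num.Theory.
Import numFieldNormedType.Exports.

Local Open Scope classical_set_scope.
Local Open Scope ring_scope.

Section convexity.
Context {R : realType} {E : lmodType R}.
Implicit Types (S F : set E) (p q s x y : E) (t : R).

Definition extreme_points S : set E :=
  [set p | S p /\ forall x y t, S x -> S y -> 0 < t < 1 ->
     t *: x + (1 - t) *: y = p -> x = p /\ y = p].

(* Faces are not required to be closed or nonempty. *)
Definition face S F : Prop :=
  [/\ F `<=` S, convex_set F &
      forall x y t, S x -> S y -> 0 < t < 1 ->
        F (t *: x + (1 - t) *: y) -> F x /\ F y].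

Definition complementary_set S F : set E :=
  \bigcup_(G in [set G | face S G /\ [disjoint F & G]%classic]) G.

(* Uniqueness of the representation is that of the whole triple (t, p, q). *)
Definition split_face S F : Prop :=
  [/\ face S F,
      convex_set (complementary_set S F) &
      forall s, S s -> ~ (F `|` complementary_set S F) s ->
        exists! tpq : R * E * E, let: (t, p, q) := tpq in
          [/\ 0 < t < 1, F p, complementary_set S F q &
              s = t *: p + (1 - t) *: q]].

End convexity.

Section sup_abs.
Context {R : realType} {T : Type} (A : set T).
Implicit Types f g : T -> R.

Definition sup_abs f : R := sup [set `|f x| | x in A].

Definition bounded_abs f := exists M, forall x, A x -> `|f x| <= M.

Lemma sup_abs_ub f : bounded_abs f -> forall x, A x -> `|f x| <= sup_abs f.
Proof.
move=> [M fM] x Ax; apply: ub_le_sup; last by exists x.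
by exists M => _ [y Ay <-]; exact: fM.
Qed.

Lemma sup_abs_ge0 f : bounded_abs f -> 0 <= sup_abs f.
Proof.
move=> bf; have [A0|/set0P[x Ax]] := eqVneq A set0.
  by rewrite /sup_abs A0 image_set0 sup0.
exact: le_trans (sup_abs_ub bf Ax).
Qed.

Lemma sup_abs_le f M : 0 <= M -> (forall x, A x -> `|f x| <= M) ->
  sup_abs f <= M.
Proof.
move=> M0 fM; have [A0|/set0P[x Ax]] := eqVneq A set0.
  by rewrite /sup_abs A0 image_set0 sup0.
apply: ge_sup; first by exists `|f x|, x.
by move=> _ [y Ay <-]; exact: fM.
Qed.

Lemma sup_absD f g : bounded_abs f -> bounded_abs g ->
  sup_abs (fun x => f x + g x) <= sup_abs f + sup_abs g.
Proof.
move=> bf bg; apply: sup_abs_le; first by rewrite addr_ge0 ?sup_abs_ge0.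
move=> x Ax; apply: le_trans (ler_normD _ _) _.
by rewrite lerD ?sup_abs_ub.
Qed.

Lemma sup_absZ f (k : R) : bounded_abs f ->
  sup_abs (fun x => k * f x) = `|k| * sup_abs f.
Proof.
move=> bf.
have bkf : bounded_abs (fun x => k * f x).
  by exists (`|k| * sup_abs f) => x Ax; rewrite normrM ler_wpM2l ?sup_abs_ub.
apply/eqP; rewrite eq_le; apply/andP; split.
  apply: sup_abs_le; first by rewrite mulr_ge0 ?sup_abs_ge0.
  by move=> x Ax; rewrite normrM ler_wpM2l ?sup_abs_ub.
have [k0|k0] := eqVneq k 0.
  by rewrite {1}k0 normr0 mul0r; exact: sup_abs_ge0.
rewrite -ler_pdivlMl ?normr_gt0//; apply: sup_abs_le.
  by rewrite mulr_ge0 ?invr_ge0// sup_abs_ge0.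
move=> x Ax; rewrite ler_pdivlMl ?normr_gt0// -normrM.
exact: (sup_abs_ub bkf).
Qed.

End sup_abs.

Section dual.
Context {R : realType} (V : normedModType R).

Definition bounded_linear : {pred V -> R^o} := mem [set f : V -> R^o |
  linear f /\ exists M : R, forall x, `|f x| <= M * `|x| ].

Record dual := Dual { dual_fun :> V -> R^o ; _ : dual_fun \in bounded_linear }.

HB.instance Definition _ := [isSub for dual_fun].
HB.instance Definition _ := [Choice of dual by <:].

Lemma bounded_linear_submod_closed : submod_closed bounded_linear.
Proof.
split.
  rewrite inE; split; first by move=> a x y /=; rewrite scaler0 addr0.
  by exists 0 => x; rewrite normr0 mul0r.
move=> a f g; rewrite !inE => -[lf [M fM]] [lg [N gN]]; split.
  move=> k x y /=.
  rewrite -![(_ + _ : V -> R^o) _]/(_ + _) -![(a *: f) _]/(a *: _).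
  by rewrite lf lg !scalerDr !scalerA [a * k]mulrC addrACA.
exists (`|a| * M + N) => x.
apply: le_trans (ler_normD _ _) _; rewrite mulrDl lerD//.
by rewrite [leLHS]normrM -mulrA ler_wpM2l.
Qed.

HB.instance Definition _ := GRing.isSubmodClosed.Build R (V -> R^o)
  bounded_linear bounded_linear_submod_closed.
HB.instance Definition _ := [SubChoice_isSubLmodule of dual by <:].

Lemma dual_linear (f : dual) : linear f.
Proof. by case: f => f /=; rewrite inE => -[]. Qed.

HB.instance Definition _ (f : dual) :=
  GRing.isLinear.Build R V R^o _ (dual_fun f) (dual_linear f).

Lemma dual_bounded (f : dual) :
  bounded_abs [set x : V | `|x| <= 1] (f : V -> R).
Proof.
case: f => f /=; rewrite inE => -[_ [M fM]].
exists `|M| => x /= x1; apply: le_trans (fM x) _.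
apply: (@le_trans _ _ (`|M| * `|x|)).
  by rewrite ler_wpM2r// ler_norm.
by rewrite -[leRHS]mulr1 ler_wpM2l.
Qed.

Definition dual_norm (f : dual) : R :=
  sup_abs [set x : V | `|x| <= 1] (f : V -> R).

Lemma ler_dual_normD f g : dual_norm (f + g) <= dual_norm f + dual_norm g.
Proof. exact: (sup_absD (dual_bounded f) (dual_bounded g)). Qed.

Lemma dual_normZ (k : R) f : dual_norm (k *: f) = `|k| * dual_norm f.
Proof. exact: (sup_absZ k (dual_bounded f)). Qed.

Lemma dual_norm_eq0 f : dual_norm f = 0 -> f = 0.
Proof.
move=> f0; apply/val_inj/funext => x /=.
have [->|x0] := eqVneq x 0; first by rewrite linear0.
have nx : `|x| != 0 by rewrite normr_eq0.
have: `|f (`|x|^-1 *: x)| <= 0.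
  rewrite -f0; apply: (sup_abs_ub (dual_bounded f)) => /=.
  by rewrite normrZ ger0_norm ?invr_ge0// mulVf.
rewrite linearZ/= normr_le0 mulf_eq0 invr_eq0 (negbTE nx) /=.
by move/eqP.
Qed.

HB.instance Definition _ := @Lmodule_isNormed.Build R dual dual_norm
  ler_dual_normD dual_normZ dual_norm_eq0.

End dual.

Section canonical_embedding.
Context {R : realType} (V : normedModType R).

Lemma dual_le (f : dual V) (x : V) : `|f x| <= `|f| * `|x|.
Proof.
have [->|x0] := eqVneq x 0; first by rewrite linear0 !normr0 mulr0.
have nx : 0 < `|x| by rewrite normr_gt0.
have : `|f (`|x|^-1 *: x)| <= `|f|.
  apply: (sup_abs_ub (dual_bounded f)) => /=.
  by rewrite normrZ ger0_norm ?invr_ge0// mulVf// gt_eqF.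
rewrite linearZ/= [X in X <= _]normrM ger0_norm ?invr_ge0// ler_pdivrMl//.
by rewrite mulrC.
Qed.

Lemma eval_bounded_linear (x : V) :
  (fun f : dual V => f x) \in @bounded_linear R (dual V).
Proof.
rewrite inE; split; first by [].
by exists `|x| => f; rewrite mulrC dual_le.
Qed.

Definition bidual_embed (x : V) : dual (dual V) :=
  Dual (eval_bounded_linear x).

Lemma bidual_embed_linear : linear bidual_embed.
Proof. by move=> a x y; apply/val_inj/funext => f /=; rewrite linearP. Qed.

HB.instance Definition _ := GRing.isLinear.Build R V (dual (dual V)) _
  bidual_embed bidual_embed_linear.

End canonical_embedding.

Section subspaces.
Context {R : realType}.

Section normed_subspace.
Context {V : normedModType R} (Y : submodClosed V).

Record subspace_of := SubspaceOf { subspace_val :> V ; _ : subspace_val \in Y }.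

HB.instance Definition _ := [isSub for subspace_val].
HB.instance Definition _ := [Choice of subspace_of by <:].
HB.instance Definition _ := [SubChoice_isSubLmodule of subspace_of by <:].

Let nrm (y : subspace_of) : R := `|val y|.

Let nrmD y z : nrm (y + z) <= nrm y + nrm z.
Proof. exact: ler_normD. Qed.

Let nrmZ (k : R) y : nrm (k *: y) = `|k| * nrm y.
Proof. exact: normrZ. Qed.

Let nrm_eq0 y : nrm y = 0 -> y = 0.
Proof. by move=> y0; apply: val_inj; apply: normr0_eq0. Qed.

HB.instance Definition _ := @Lmodule_isNormed.Build R subspace_of nrm
  nrmD nrmZ nrm_eq0.

End normed_subspace.

Section image.
Context {V W : lmodType R} (f : {linear V -> W}) (Y : submodClosed V).

Definition image_subspace : {pred W} := mem [set f y | y in [set` Y]].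

Lemma image_submod_closed : submod_closed image_subspace.
Proof.
split; first by rewrite inE; exists 0; rewrite ?linear0//= rpred0.
move=> a _ _ /set_mem[y /= yY <-] /set_mem[z /= zY <-]; rewrite inE.
by exists (a *: y + z); rewrite ?linearP//= rpredD// rpredZ.
Qed.

HB.instance Definition _ := GRing.isSubmodClosed.Build R W
  image_subspace image_submod_closed.

End image.

Definition attains_norm {V : normedModType R} (g : dual V) : Prop :=
  exists2 y : V, `|y| <= 1 & `|g y| = `|g|.

Definition property_wU {X : normedModType R} (Y : submodClosed X) : Prop :=
  forall g : dual (subspace_of Y), attains_norm g ->
    exists! h : dual X,
      (forall y : subspace_of Y, h (val y) = g y) /\ `|h| = `|g|.

End subspaces.

Section affine_continuous.
Context {R : realType} {E : tvsType R} {S : set E}.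

(* [S] stands for the subtype [set_type S] with the induced topology. *)
Definition affine_continuous : {pred S -> R^o} := mem [set f : S -> R^o |
  continuous f /\
  forall (x y z : S) (t : R), 0 <= t <= 1 ->
    val z = t *: val x + (1 - t) *: val y -> f z = t * f x + (1 - t) * f y].

(* The compactness proof is a parameter of the type because the supremum
   norm needs it. *)
Record aff_space (cS : compact S) :=
  AffSpace { aff_fun :> S -> R^o ; _ : aff_fun \in affine_continuous }.

Variable cS : compact S.
Local Notation AS := (aff_space cS).

HB.instance Definition _ := [isSub for @aff_fun cS].
HB.instance Definition _ := [Choice of AS by <:].

Lemma affine_continuous_submod_closed : submod_closed affine_continuous.
Proof.
split.
  rewrite inE; split; first exact: (@cst_continuous S R^o 0).
  by move=> x y z t _ _ /=; rewrite !mulr0 addr0.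
move=> a f g; rewrite !inE => -[cf af] [cg ag]; split.
  move=> x; have caf := @cvgZl_tmp R R^o S (nbhs x) (nbhs_filter x) a f (f x) (cf x).
  exact: (@cvgD R R^o S (nbhs x) (nbhs_filter x) _ _ _ _ caf (cg x)).
move=> x y z t t01 zxy.
rewrite -![(_ + _ : S -> R^o) _]/(_ + _) -![(a *: f) _]/(a * _).
rewrite (af x y z t t01 zxy) (ag x y z t t01 zxy).
by rewrite !mulrDr !mulrA ![a * _]mulrC addrACA.
Qed.

HB.instance Definition _ := GRing.isSubmodClosed.Build R (S -> R^o)
  affine_continuous affine_continuous_submod_closed.
HB.instance Definition _ := [SubChoice_isSubLmodule of AS by <:].

Lemma aff_space_bounded (f : AS) : bounded_abs [set: S] (f : S -> R).
Proof.
case: f => f /=; rewrite inE => -[cf _].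
have : {within S, continuous (valL f)} by apply/subspace_valL_continuousP.
move=> /continuous_compact /(_ cS) /compact_bounded.
move=> /pinfty_ex_gt0 [M M0 fM].
exists M => x _; apply: fM; exists (val x); first exact: set_valP.
by have := valLK point f => /(congr1 (fun h : S -> R^o => h x)).
Qed.

Definition aff_norm (f : AS) : R := sup_abs [set: S] (f : S -> R).

Lemma ler_aff_normD f g : aff_norm (f + g) <= aff_norm f + aff_norm g.
Proof. exact: (sup_absD (aff_space_bounded f) (aff_space_bounded g)). Qed.

Lemma aff_normZ (k : R) f : aff_norm (k *: f) = `|k| * aff_norm f.
Proof. exact: (sup_absZ k (aff_space_bounded f)). Qed.

Lemma aff_norm_eq0 f : aff_norm f = 0 -> f = 0.
Proof.
move=> f0; apply/val_inj/funext => x /=; apply/eqP; rewrite -normr_le0.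
by rewrite -f0; exact: (sup_abs_ub (aff_space_bounded f)).
Qed.

HB.instance Definition _ := @Lmodule_isNormed.Build R AS aff_norm
  ler_aff_normD aff_normZ aff_norm_eq0.

End affine_continuous.

(* Main.v *)
Require Import Defs.
From HB Require Import structures.
From mathcomp Require Import all_boot all_order all_algebra.
From mathcomp Require Import all_classical all_reals all_analysis.
From mathcomp Require Import ring lra.

(* Let [f != 0] in [Y]. By Bauer's principle [|f|] attains its maximum at an
   extreme point [p], so the evaluation [d_p] restricted to [Y] has norm 1 and
   attains it. One norm-preserving extension to [A(S)**] is [Phi |-> Phi d_p].
   Another is a limit, along an ultrafilter of extreme points [q <> p]
   converging to [p], of [Phi |-> Phi d_q]. They differ: since [{p}] is a split
   face, the coefficient [chi] of [p] is an affine function on [S] with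
   [chi p = 1] and [chi q = 0] at every other extreme point. Every [mu] in
   [A(S)*] is of the form [|mu| (t d_x - (1 - t) d_y)], so [chi] induces an
   element [F] of [A(S)**], and the two extensions take the values 1 and 0 at
   [F]. *)

Set Implicit Arguments.
Unset Strict Implicit.
Unset Printing Implicit Defensive.

Import Order.TTheory GRing.Theory Num.Theory.
Import numFieldNormedType.Exports.

Local Open Scope classical_set_scope.
Local Open Scope ring_scope.

(** * The Hahn-Banach theorem for sublinear functionals *)

Section hahn_banach.
Context {R : realType} {V : lmodType R}.
Implicit Types (p q : V -> R) (x y : V).

(** Homogeneity is asked only as an inequality for [c > 0], the form that passes to infima;
    [sublinearZ] recovers equality by scaling back with [c^-1]. *)
Definition sublinear p :=
  (forall x y, p (x + y) <= p x + p y) /\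
  (forall c x, 0 < c -> p (c *: x) <= c * p x).

Lemma sublinear0 p : sublinear p -> p 0 = 0.
Proof.
move=> [pD pZ]; have := pD 0 0; have /(pZ _ 0) : (0 : R) < 2^-1 by lra.
by rewrite scaler0 addr0; lra.
Qed.

Lemma sublinearZ p c x : sublinear p -> 0 <= c -> p (c *: x) = c * p x.
Proof.
move=> sp; rewrite le_eqVlt => /predU1P[<-|c0].
  by rewrite scale0r mul0r sublinear0.
apply/eqP; rewrite eq_le (proj2 sp)//=.
have /(proj2 sp _ (c *: x)) : 0 < c^-1 by rewrite invr_gt0.
by rewrite scalerK ?gt_eqF// ler_pdivlMl.
Qed.

Lemma sublinearN p x : sublinear p -> - p (- x) <= p x.
Proof.
move=> sp; have := proj1 sp x (- x); rewrite subrr (sublinear0 sp).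
by lra.
Qed.

(** The lower bound [b] keeps the infima finite. The index [k] may depend on [i] and [j]: along a
    chain it is the smaller of two functionals, for translates it is the sum of the two
    parameters. *)
Lemma sublinear_inf (I : Type) (A : set I) (g : I -> V -> R) (b : V -> R) :
  A !=set0 -> (forall i x, A i -> b x <= g i x) ->
  (forall i j x y, A i -> A j ->
     exists2 k, A k & g k (x + y) <= g i x + g j y) ->
  (forall i c x, A i -> 0 < c -> exists2 k, A k & g k (c *: x) <= c * g i x) ->
  sublinear (fun x => inf [set g i x | i in A]).
Proof.
move=> [i0 Ai0] gb gD gZ.
have ub i x : A i -> inf [set g i x | i in A] <= g i x.
  move=> Ai; apply: ge_inf; last by exists i.
  by exists (b x) => _ [j Aj <-]; exact: gb.
have inf_lb x m : (forall i, A i -> m <= g i x) ->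
    m <= inf [set g i x | i in A].
  move=> mg; apply: lb_le_inf; first by exists (g i0 x), i0.
  by move=> _ [i Ai <-]; exact: mg.
split=> [x y|c x c0].
  rewrite -lerBlDr; apply: (inf_lb) => i Ai; rewrite lerBlDr -lerBlDl.
  apply: (inf_lb) => j Aj; rewrite lerBlDl.
  by have [k Ak] := gD i j x y Ai Aj; apply: le_trans; rewrite ub.
rewrite mulrC -ler_pdivrMr//; apply: (inf_lb) => i Ai.
rewrite ler_pdivrMr// mulrC.
by have [k Ak] := gZ i c x Ai c0; apply: le_trans; rewrite ub.
Qed.

Lemma sublinear_minimal p : sublinear p ->
  exists2 q, sublinear q /\ (forall x, q x <= p x) &
    forall r, sublinear r -> (forall x, r x <= q x) -> r = q.
Proof.
move=> sp; pose T := {q | sublinear q /\ (forall x, q x <= p x)}.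
pose le (q r : T) := `[< forall x, sval r x <= sval q x >].
have [||||[q [sq qp]] qmin] := @Zorn T le.
- by move=> q; apply/asboolP => x.
- move=> q r s /asboolP qr /asboolP rs; apply/asboolP => x.
  exact: le_trans (rs x) (qr x).
- move=> [q ?] [r ?] /asboolP qr /asboolP rq; apply: eq_exist.
  by apply/funext => x; apply/le_anti; rewrite qr rq.
- move=> A tA; have [->|A0] := eqVneq A set0.
    by exists (exist _ p (conj sp (fun x => lexx (p x)))).
  have {A0} /set0P A0 := A0.
  pose q x := inf [set sval r x | r in A].
  (* Every member lies below [p], hence above [- p (- x)], so the infimum of the chain is finite. *)
  have Alb (r : T) x : A r -> - p (- x) <= sval r x.
    move=> _; case: r => r [sr rp] /=; apply: le_trans (sublinearN x sr).
    by rewrite lerN2.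
  have sq : sublinear q.
    apply: (@sublinear_inf _ _ (fun r : T => sval r)
      (fun x => - p (- x))) => //.
      move=> r s x y Ar As.
      have [/asboolP sr|/asboolP rs] := tA r s Ar As.
        exists s => //; case: s sr {As} => s [ss sp'] /= sr.
        by apply: le_trans (proj1 ss x y) _; rewrite lerD2r.
      exists r => //; case: r rs {Ar} => r [sr rp] /= rs.
      by apply: le_trans (proj1 sr x y) _; rewrite lerD2l.
    move=> r c x Ar c0; exists r => //.
    by case: r {Ar} => r [[]/= _ + _]; apply.
  have qle r x : A r -> q x <= sval r x.
    move=> Ar; apply: ge_inf; last by exists r.
    by exists (- p (- x)) => _ [s As <-]; exact: Alb.
  have qp x : q x <= p x.
    by have [r Ar] := A0; apply: le_trans (qle r x Ar) (proj2 (svalP r) x).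
  exists (exist _ q (conj sq qp)) => r Ar; apply/asboolP => x; exact: qle.
exists q => // r sr rq.
have rp x : r x <= p x := le_trans (rq x) (qp x).
suff /qmin/(congr1 sval) :
  le (exist _ q (conj sq qp)) (exist _ r (conj sr rp)) by [].
exact/asboolP.
Qed.

(* A minimal sublinear functional [q] is additive since it coincides with its
   infimal translates [x |-> inf_(t >= 0) (q (x + t a) - t q a)]. *)
Let translate q (a x : V) : R :=
  inf [set q (x + t *: a) - t * q a | t in [set t | 0 <= t]].

Let translate_lb q a x t : sublinear q -> 0 <= t ->
  - q (- x) <= q (x + t *: a) - t * q a.
Proof.
move=> sq t0; have := proj1 sq (x + t *: a) (- x).
by rewrite addrAC subrr add0r sublinearZ//; lra.
Qed.

Let translate_ub q a x t : sublinear q -> 0 <= t ->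
  translate q a x <= q (x + t *: a) - t * q a.
Proof.
move=> sq t0; apply: ge_inf; last by exists t.
by exists (- q (- x)) => _ [s s0 <-]; exact: translate_lb.
Qed.

Let translate_sublinear q a : sublinear q -> sublinear (translate q a).
Proof.
move=> sq; apply: (@sublinear_inf _ _ (fun t x => q (x + t *: a) - t * q a)
    (fun x => - q (- x))).
- by exists 0 => /=.
- by move=> t x /= t0; exact: translate_lb.
- move=> s t x y /= s0 t0; exists (s + t); first by rewrite /= addr_ge0.
  have := proj1 sq (x + s *: a) (y + t *: a).
  by rewrite addrACA -scalerDl; lra.
- move=> t c x /= t0 c0; exists (c * t); first by rewrite /= mulr_ge0// ltW.
  have := proj2 sq c (x + t *: a) c0.
  by rewrite scalerDr scalerA mulrBr mulrA; lra.
Qed.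

Lemma hahn_banach p a : sublinear p ->
  exists f : {linear V -> R^o}, (forall x, f x <= p x) /\ f a = p a.
Proof.
move=> sp.
(* Minimising below the translate of [p] along [a], rather than below [p], yields [q (- a) <= - p a]
   from [t = 1], which forces [q a = p a]. *)
have [q [sq qp] qmin] := sublinear_minimal (translate_sublinear a sp).
have qD x y : q (x + y) = q x + q y.
  apply/eqP; rewrite eq_le (proj1 sq)/=.
  have tq z : translate q y z <= q z.
    by have := translate_ub y z sq (lexx 0); rewrite scale0r mul0r subr0 addr0.
  have := translate_ub y x sq ler01.
  by rewrite (qmin _ (translate_sublinear y sq) tq) scale1r mul1r; lra.
have qN x : q (- x) = - q x.
  by apply/eqP; rewrite -addr_eq0 -qD addNr (sublinear0 sq).
have qlin : linear (q : V -> R^o).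
  move=> c x y; rewrite qD; congr (_ + _).
  have [c0|/ltW c0] := leP 0 c; first exact: sublinearZ.
  by rewrite -[c]opprK scaleNr qN sublinearZ ?oppr_ge0// scaleNr.
pose F := GRing.isLinear.Build R V R^o _ _ qlin.
pose f : {linear V -> R^o} := HB.pack (q : V -> R^o) F.
exists f; split=> [x|] /=.
  apply: le_trans (qp x) _.
  by have := translate_ub a x sp (lexx 0); rewrite scale0r mul0r subr0 addr0.
apply/le_anti/andP; split.
  apply: le_trans (qp a) _.
  by have := translate_ub a a sp (lexx 0); rewrite scale0r mul0r subr0 addr0.
rewrite -lerN2 -qN; apply: le_trans (qp _) _.
have := translate_ub a (- a) sp ler01.
by rewrite scale1r mul1r addNr (sublinear0 sp) sub0r.
Qed.

End hahn_banach.

(** * Separation of points in a locally convex space *)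

Lemma convex_setP (R : realType) (E : lmodType R) (A : set E) :
  convex_set A <-> forall x y (t : R), A x -> A y -> 0 <= t <= 1 ->
    A (t *: x + (1 - t) *: y).
Proof.
split=> [cA x y t Ax Ay t01|cA x y k /set_mem Ax /set_mem Ay].
  have /andP[t0 t1] := t01.
  exact: (set_mem (cA x y (Itv01 t0 t1) (mem_set Ax) (mem_set Ay))).
apply/mem_set/(cA x y k%:num) => //.
by rewrite ge0 le1.
Qed.

Section separation.
Context {R : realType} {E : tvsType R}.

Section gauge.
Variable U : set E.
Hypotheses (U_convex : convex_set U) (U0 : nbhs 0 U).

Definition gauge_fun (x : E) : R := inf [set t | 0 < t /\ U (t^-1 *: x)].

Lemma absorbing x : exists t : R, 0 < t /\ U (t^-1 *: x).
Proof.
have : (fun t : R^o => t *: x) @ (0 : R^o) --> (0 : E).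
  rewrite -[X in _ --> X](scale0r x).
  apply: (@continuous_comp _ (R^o * E)%type _ (fun t : R^o => (t, x))
    (fun z => z.1 *: z.2)); last exact: scale_continuous.
  apply: (@cvg_pair _ _ _ (nbhs (0 : R^o)) (nbhs (0 : R^o)) (nbhs x)).
    exact: cvg_id.
  exact: cvg_cst.
move=> /(_ U U0) /nbhs_ballP[e /= e0 eU].
(* The inverse [e / 2] lies in the ball of radius [e] whose scalars send [x] into [U]. *)
exists (2 / e); split; first by rewrite divr_gt0.
rewrite invf_div; apply: eU.
rewrite /ball /= sub0r normrN ger0_norm; last first.
  by rewrite divr_ge0 ?ltW.
by rewrite ltr_pdivrMr// ltr_pMr// ltr1n.
Qed.

Lemma gauge_le x t : 0 < t -> U (t^-1 *: x) -> gauge_fun x <= t.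
Proof.
move=> t0 Ut; apply: ge_inf; last by [].
by exists 0 => s [/ltW].
Qed.

Lemma gauge_ge x m : (forall t, 0 < t -> U (t^-1 *: x) -> m <= t) ->
  m <= gauge_fun x.
Proof.
move=> mt; apply: lb_le_inf; first exact: absorbing.
by move=> t [t0 Ut]; exact: mt.
Qed.

Lemma gauge_sublinear : sublinear gauge_fun.
Proof.
move/convex_setP: U_convex => cU; split=> [x y|c x c0].
  rewrite -lerBlDr; apply: gauge_ge => s s0 Us; rewrite lerBlDr -lerBlDl.
  apply: gauge_ge => t t0 Ut; rewrite lerBlDl.
  have st0 : 0 < s + t by rewrite addr_gt0.
  apply: gauge_le => //.
  rewrite [_ *: _](_ : _ = s / (s + t) *: (s^-1 *: x) +
      (1 - s / (s + t)) *: (t^-1 *: y)); last first.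
    rewrite !scalerA scalerDr; congr (_ *: _ + _ *: _); field.
      by rewrite !gt_eqF.
    by rewrite !gt_eqF.
  apply: cU => //; rewrite divr_ge0 ?(ltW s0) ?(ltW st0)//=.
  by rewrite ler_pdivrMr// mul1r lerDl ltW.
rewrite mulrC -ler_pdivrMr//; apply: gauge_ge => t t0 Ut.
rewrite ler_pdivrMr// mulrC; apply: gauge_le; first by rewrite mulr_gt0.
by rewrite scalerA invfM mulrC mulrA mulfV ?gt_eqF// mul1r.
Qed.

End gauge.

Lemma sub_cvg0 (x : E) : (fun y => x - y) @ x --> (0 : E).
Proof.
rewrite -[X in _ --> X](subrr x).
apply: (@continuous_comp _ (E * E)%type _ (fun y => (x, y))
  (fun z => z.1 - z.2)); last exact: sub_continuous.
apply: (@cvg_pair _ _ _ (nbhs x) (nbhs x) (nbhs x) (nbhs_filter x)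
  (nbhs_filter x) (nbhs_filter x)); [exact: cvg_cst|exact: cvg_id].
Qed.

(** A one-sided bound suffices: on the intersection of [e U] and [- e U] it gives [|f| <= e], and
    linearity moves continuity at 0 to every point. *)
Lemma linear_continuous_nbhs0 (f : {linear E -> R^o}) (U : set E) :
  nbhs 0 U -> (forall x, U x -> f x <= 1) -> continuous f.
Proof.
move=> U0 fU.
have small (e : R) : 0 < e -> \forall x \near (0 : E), `|f x| <= e.
  move=> e0; have e1 : e != 0 by rewrite gt_eqF.
  have Ne1 : - e != 0 by rewrite oppr_eq0.
  apply: filterS (filterI (nbhs0Z e1 U0) (nbhs0Z Ne1 U0)).
  move=> _ [[u Uu <-] [v Uv vu]]; rewrite ler_norml; apply/andP; split.
    rewrite -vu linearZ/= [leRHS]mulNr lerN2 -[leRHS]mulr1.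
    by rewrite ler_pM2l// fU.
  by rewrite linearZ/= -[leRHS]mulr1 [leLHS]/(e * _) ler_pM2l// fU.
move=> x; apply/cvgrPdist_le => /= e e0.
have subx := @sub_cvg0 x.
have := subx _ (small e e0); rewrite nbhs_simpl /=.
by apply: filterS => y /=; rewrite linearB.
Qed.

(** Hahn-Banach is applied to the gauge of a convex neighbourhood [U] of 0 that misses [x]: the
    gauge is at most 1 on [U], whence continuity, and at least 1 at [x]. *)
Lemma separating_functional (x : E) : hausdorff_space E -> x != 0 ->
  exists2 f : {linear E -> R^o}, continuous f & f x != 0.
Proof.
move=> hE x0.
have [U [cU U0 Ux]] : exists U : set E, [/\ convex_set U, nbhs 0 U & ~ U x].
  have [B cB [Bo Bb]] := @locally_convex R E.
  have [|A [oA /set_mem A0 /set_mem Ax]] :=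
      hausdorff_accessible hE (_ : 0 != x).
    by rewrite eq_sym.
  have [U [BU U0] UA] := Bb 0 A (open_nbhs_nbhs (conj oA A0)).
  exists U; split; first by apply/cB/mem_set.
  - by apply: open_nbhs_nbhs; split=> //; exact: Bo.
  - by move=> /UA.
have [f [fU fx]] := hahn_banach x (gauge_sublinear cU U0).
exists f.
  apply: (linear_continuous_nbhs0 U0) => y Uy.
  by apply: le_trans (fU y) _; apply: gauge_le => //; rewrite invr1 scale1r.
have : 1 <= gauge_fun U x.
  apply: gauge_ge => // t t0 Ut; rewrite leNgt; apply/negP => t1; apply: Ux.
  move/convex_setP : cU => /(_ _ 0 t Ut).
  rewrite scaler0 addr0 scalerA mulfV ?gt_eqF// scale1r.
  by apply; [exact: nbhs_singleton|rewrite !ltW].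
by rewrite -fx; apply: contraTneq => ->; rewrite ler10.
Qed.

End separation.

(** * Compactness and Bauer's maximum principle *)

Lemma compact_finite_intersection (T : topologicalType) (I : eqType)
    (K : set T) (D : set I) (C : I -> set T) :
  compact K -> (forall i, D i -> closed (C i)) ->
  (forall s : seq I, (forall i, i \in s -> D i) ->
     exists2 x, K x & forall i, i \in s -> C i x) ->
  exists2 x, K x & forall i, D i -> C i x.
Proof.
move=> cK cC fip.
(* The filter generated by [K] and the sets [C i]; its cluster point lies in each closed [C i]. *)
pose F : set_system T := [set A | exists2 s : seq I, forall i, i \in s -> D i &
  forall x, K x -> (forall i, i \in s -> C i x) -> A x].
have FF : ProperFilter F.
  apply: Build_ProperFilter_ex => [A [s sD sA]|].
    by have [x Kx xC] := fip s sD; exists x; exact: sA.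
  split=> [|A B [s sD sA] [r rD rB]|A B AB [s sD sA]]; first by exists [::].
    exists (s ++ r) => [i|x Kx xC].
      by rewrite mem_cat => /orP[/sD|/rD].
    by split; [apply: sA|apply: rB] => // i si;
      apply: xC; rewrite mem_cat si ?orbT.
  by exists s => // x Kx xC; apply/AB/sA.
have [|x [Kx clx]] := cK F FF; first by exists [::].
exists x => // i Di; apply: cC => // B Bx.
apply: clx => //; exists [:: i] => [j|y Ky]; first by rewrite inE => /eqP ->.
by apply; rewrite inE.
Qed.

Lemma compact_set_type (T : topologicalType) (S : set T) :
  compact S -> compact [set: S].
Proof.
move=> cS F FF _.
have [|x [Sx clx]] := cS (val @ F) _.
  by apply: (@filterS _ F _ setT) filterT => x _ /=; exact: set_valP.
exists (SigSub (mem_set Sx)); split=> // A B FA [_ [[W oW <-] /= Wx] WB].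
have [|y [[z Az <-] Wz]] := clx (val @` A) W _ (open_nbhs_nbhs (conj oW Wx)).
  by apply: (@filterS _ F _ A _ _ FA) => z Az; exists z.
by exists z; split=> //; exact: WB.
Qed.

Section bauer.
Context {R : realType} {E : tvsType R} {S : set E} (cS : compact S).
Hypothesis hausdorffE : hausdorff_space E.
Implicit Types (f : aff_space cS) (x y z p : S).

Lemma aff_continuous f : continuous (f : S -> R^o).
Proof. by case: f => f /=; rewrite inE => -[]. Qed.

Lemma aff_affine f x y z t : 0 <= t <= 1 ->
  val z = t *: val x + (1 - t) *: val y -> f z = t * f x + (1 - t) * f y.
Proof. by case: f => f /=; rewrite inE => -[_]; apply. Qed.

Lemma aff_le_norm f x : `|f x| <= `|f|.
Proof. exact: (sup_abs_ub (aff_space_bounded f)). Qed.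

Lemma aff_separates x y : (forall f, f x = f y) -> x = y.
Proof.
move=> fxy; apply: contrapT => xy.
have vxy : val x - val y != 0.
  by rewrite subr_eq0; apply/eqP => /val_inj.
have [f cf] := separating_functional hausdorffE vxy.
have fA : (fun z : S => f (val z)) \in @affine_continuous R E S.
  rewrite inE; split=> [z|u v w t _ /= ->]; last by rewrite linearD !linearZ.
  by apply: continuous_comp; [exact: initial_continuous|exact: cf].
by rewrite linearB subr_eq0 => /eqP; apply; exact: (fxy (AffSpace cS fA)).
Qed.

Lemma affZ c f x : (c *: f) x = c * f x :> R.
Proof. by []. Qed.

(** The extremality clause of a face alone, on the subtype: it passes to intersections and to sets
    of maximisers. *)
Definition extremal (H : set S) := forall x y z t, 0 < t < 1 ->
  val z = t *: val x + (1 - t) *: val y -> H z -> H x /\ H y.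

Lemma extremal_argmax f (H : set S) x0 : extremal H -> H x0 ->
  (forall x, H x -> f x <= f x0) -> extremal (H `&` [set x | f x = f x0]).
Proof.
move=> eH Hx0 fx0 x y z t t01 zE [Hz /= fz].
have [Hx Hy] := eH x y z t t01 zE Hz; have := fx0 x Hx; have := fx0 y Hy.
have t01' : 0 <= t <= 1 by rewrite !ltW//; case/andP: t01.
have := aff_affine f t01' zE; rewrite fz; case/andP: t01 => t0 t1 fE fy fx.
by split; split=> //=; nra.
Qed.

(** By Zorn, [H] contains a minimal closed nonempty extremal set. Each [f] in [A(S)] is constant on
    it, since the maximisers of [f] form a smaller such set; as [A(S)] separates points, it is a
    singleton. *)
Lemma extremal_extreme_point (H : set S) :
  closed H -> H !=set0 -> extremal H ->
  exists2 p, H p & extreme_points S (val p).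
Proof.
move=> cH H0 eH.
pose P (G : set S) := [/\ closed G, G !=set0, extremal G & G `<=` H].
pose le (G G' : {G : set S | P G}) := `[< sval G' `<=` sval G >].
have [||||[G [cG [p Gp] eG GH] Gmin]] := @Zorn _ le.
- by move=> G; apply/asboolP.
- move=> G1 G2 G3 /asboolP G12 /asboolP G23; apply/asboolP.
  exact: subset_trans G12.
- move=> [G ?] [G' ?] /asboolP /= GG' /asboolP /= G'G; apply: eq_exist.
  exact/seteqP.
- move=> A tA; have [->|/set0P[G0 AG0]] := eqVneq A set0.
    by exists (exist _ H (And4 cH H0 eH (@subset_refl _ H))).
  pose C := \bigcap_(G in A) sval G.
  have PC : P C.
    split.
    - by apply: closed_bigI => G _; case: (svalP G).
    - have [||x _ xC] := @compact_finite_intersection _ {classic {G | P G}} _ A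
        sval (compact_set_type cS).
      + by move=> G _; case: (svalP G).
      (* Finitely many members of a chain contain a common member, which is nonempty. *)
      + move=> s sA; suff [G AG Gs] : exists2 G, A G &
            forall G', G' \in s -> sval G `<=` sval G'.
          have [_ [x Gx] _ _] := svalP G; exists x => // G' /Gs; exact.
        elim: s sA => [|G s IH] sA; first by exists G0.
        have [|G1 AG1 G1s] := IH.
          by move=> i si; apply: sA; rewrite inE si orbT.
        have AG : A G by apply: sA; rewrite inE eqxx.
        have [/asboolP GG1|/asboolP G1G] := tA G G1 AG AG1.
          by exists G1 => // G'; rewrite inE => /predU1P[->//|/G1s].
        exists G => // G'; rewrite inE => /predU1P[->//|/G1s].
        exact: subset_trans.
      + by exists x => G /xC.
    - move=> x y z t t01 zE Cz; split=> G AG.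
        by case: (svalP G) => _ _ /(_ x y z t t01 zE (Cz G AG))[].
      by case: (svalP G) => _ _ /(_ x y z t t01 zE (Cz G AG))[].
    - by move=> x /(_ G0 AG0); case: (svalP G0) => _ _ _; apply.
  by exists (exist _ C PC) => G AG; apply/asboolP => x; exact.
have Gp1 x : G x -> x = p.
  move=> Gx; apply: aff_separates => f.
  have cG' : compact G :=
    subclosed_compact cG (compact_set_type cS) (@subsetT _ G).
  have cf : {within G, continuous (f : S -> R^o)}.
    exact/continuous_subspaceT/aff_continuous.
  have [y /set_mem Gy fy] := compact_EVT_max (ex_intro _ p Gp) cG' cf.
  pose G' := G `&` [set x | f x = f y].
  have PG' : P G'.
    split.
    - apply: closedI => //; apply: preimage_closed (@closed_eq _ (f y)) => z _.
      exact: aff_continuous.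
    - by exists y.
    - by apply: extremal_argmax => // z Gz; exact/fy/mem_set.
    - by move=> z [/GH].
  have /(congr1 sval)/= G'G :
      exist _ G' PG' = exist _ G (And4 cG (ex_intro _ p Gp) eG GH).
    by apply: Gmin; apply/asboolP => z [].
  have fG z : G z -> f z = f y by rewrite -G'G => -[].
  by rewrite !fG.
exists p; first exact: (GH p Gp).
split; first exact: set_valP.
move=> x y t Sx Sy t01 xyp.
have [|Gx Gy] := eG (SigSub (mem_set Sx)) (SigSub (mem_set Sy)) p t t01 _ Gp.
  by rewrite /= xyp.
by split; [rewrite -(Gp1 _ Gx)|rewrite -(Gp1 _ Gy)].
Qed.

Lemma aff_norm_extreme_point f : S !=set0 ->
  exists2 p, extreme_points S (val p) & `|f p| = `|f|.
Proof.
move=> [s0 Ss0].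
have cabs : continuous (fun x : S => `|f x| : R^o).
  move=> x; apply: continuous_comp; first exact: aff_continuous.
  exact: norm_continuous.
have [x _ xmax] := compact_EVT_max (ex_intro _ (SigSub (mem_set Ss0) : S) I)
  (compact_set_type cS) (continuous_subspaceT cabs).
have fx : `|f x| = `|f|.
  apply/le_anti; rewrite aff_le_norm /=; apply: sup_abs_le => // y _.
  by apply: xmax; rewrite inE.
(* The sign turns the maximum of [|f|] into a maximum of an affine function, whose set of maximisers
   is extremal. *)
pose g := (if 0 <= f x then 1 else -1) *: f.
have gx : g x = `|f x| by rewrite affZ; case: ger0P; rewrite ?mul1r ?mulN1r.
have gmax y : g y <= g x.
  rewrite gx fx; apply: le_trans (aff_le_norm f y).
  apply: le_trans (ler_norm _) _.
  by rewrite affZ normrM; case: ifP; rewrite ?normrN normr1 mul1r.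
have [|||p [_ gp] pext] :=
  @extremal_extreme_point (setT `&` [set y | g y = g x]).
- rewrite setTI; apply: preimage_closed (@closed_eq _ (g x)) => z _.
  exact: aff_continuous.
- by exists x.
- by apply: extremal_argmax.
exists p => //; apply/le_anti; rewrite aff_le_norm -fx -gx -gp affZ /=.
apply: le_trans (ler_norm _) _.
by rewrite normrM; case: ifP; rewrite ?normrN normr1 mul1r.
Qed.

End bauer.

(** * Functionals on [A(S)] as differences of multiples of evaluations *)

Lemma convex_comb (R : realType) (E : lmodType R) (S : set E) (x y : S)
    (a b : R) :
  convex_set S -> 0 <= a -> 0 <= b -> 0 < a + b ->
  exists z : S, val z = (a / (a + b)) *: val x + (1 - a / (a + b)) *: val y.
Proof.
move=> /convex_setP cS a0 b0 ab0.
have Sz : S (a / (a + b) *: val x + (1 - a / (a + b)) *: val y).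
  apply: cS; [exact: set_valP|exact: set_valP|].
  by rewrite divr_ge0 ?(ltW ab0)//= ler_pdivrMr// mul1r lerDl.
by exists (SigSub (mem_set Sz)).
Qed.

Lemma dual_sum (R : realType) (V : normedModType R) (nu : dual V) (s : seq V)
    (d : V -> R) :
  nu (\sum_(v <- s) d v *: v) = \sum_(v <- s) d v * nu v.
Proof. by rewrite linear_sum; apply: eq_bigr => v _; rewrite linearZ. Qed.

Section state_space.
Context {R : realType} {E : tvsType R} {S : set E} (cS : compact S).
Hypotheses (S_convex : convex_set S) (S_nonempty : S !=set0).
Implicit Types (f : aff_space cS) (x y p w : S).

Lemma ev_bounded_linear x :
  (fun f : aff_space cS => f x : R^o) \in @bounded_linear R (aff_space cS).
Proof.
rewrite inE; split; first by [].
by exists 1 => f; rewrite mul1r; exact: aff_le_norm.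
Qed.

Definition ev x : dual (aff_space cS) := Dual (ev_bounded_linear x).

Lemma ev_norm x : `|ev x| <= 1.
Proof.
by apply: sup_abs_le => // f /= f1; apply: le_trans f1; exact: aff_le_norm.
Qed.

(** The parameters are packed into one point of a product so that minimisation and compactness
    arguments can run over [[0, 1] * S * S]. *)
Definition comb (z : R * (S * S)) : dual (aff_space cS) :=
  z.1 *: ev z.2.1 - (1 - z.1) *: ev z.2.2.

Arguments comb : simpl never.

Lemma combE t x y f : comb (t, (x, y)) f = t * f x - (1 - t) * f y.
Proof. by []. Qed.

Lemma comb_continuous f : continuous (fun z => comb z f : R).
Proof.
have c1 : continuous (fun z : R * (S * S) => z.1) by move=> z; exact: cvg_fst.
have cf x : {for x, continuous (f : S -> R)} by exact: aff_continuous.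
have c2 : continuous (fun z : R * (S * S) => f z.2.1 : R).
  move=> z; apply: (@continuous_comp _ _ _ (fun z => z.2.1) f); last exact: cf.
  apply: (@continuous_comp _ _ _ snd fst); [exact: cvg_snd|exact: cvg_fst].
have c3 : continuous (fun z : R * (S * S) => f z.2.2 : R).
  move=> z; apply: (@continuous_comp _ _ _ (fun z => z.2.2) f); last exact: cf.
  apply: (@continuous_comp _ _ _ snd snd); exact: cvg_snd.
move=> z; apply: cvgB; apply: cvgM; [exact: c1|exact: c2| |exact: c3].
by apply: cvgB; [exact: cvg_cst|exact: c1].
Qed.

(** The positive masses at [x] and [w] merge at their barycentre with total [(1 - e) t + e]; the
    negative mass stays at [y] and equals the complement [(1 - e) (1 - t)]. *)
Lemma comb_convex t x y w e : 0 <= t <= 1 -> 0 < e <= 1 ->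
  exists2 z, 0 <= z.1 <= 1 & comb z = (1 - e) *: comb (t, (x, y)) + e *: ev w.
Proof.
move=> /andP[t0 t1] /andP[e0 e1].
have a0 : 0 <= (1 - e) * t by rewrite mulr_ge0// subr_ge0.
have ae0 : 0 < (1 - e) * t + e by rewrite ltr_wpDl.
have [x' x'E] := convex_comb x w S_convex a0 (ltW e0) ae0.
exists ((1 - e) * t + e, (x', y)).
  by rewrite (ltW ae0)/=; nra.
apply/val_inj/funext => f.
rewrite [LHS]combE (aff_affine _ _ x'E); last first.
  by rewrite divr_ge0 ?(ltW ae0)//= ler_pdivrMr// mul1r lerDl ltW.
have alg (a b c u : R) : u != 0 -> u = (1 - e) * t + e ->
    u * ((1 - e) * t / u * a + (1 - (1 - e) * t / u) * b) - (1 - u) * c =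
    (1 - e) * (t * a - (1 - t) * c) + e * b.
  move=> u0 uE.
  transitivity ((1 - e) * t * a + (u - (1 - e) * t) * b - (1 - u) * c).
    by field.
  by rewrite uE; ring.
by apply: alg => //; rewrite gt_eqF.
Qed.

Lemma combN t x y : comb (1 - t, (y, x)) = - comb (t, (x, y)).
Proof. by rewrite /comb /= subKr opprB. Qed.

(** Extracts a first-order condition from a minimum: [e * b] is the second-order term divided by
    [e]. If [a > 0], the choice [e = a / (a + b + 1)] is contradictory. *)
Lemma small_quadratic (a b : R) :
  0 <= b -> (forall e, 0 < e <= 1 -> a <= e * b) -> a <= 0.
Proof.
move=> b0 ab; rewrite leNgt; apply/negP => a0.
have abp : 0 < a + b + 1 by lra.
have := ab (a / (a + b + 1)).
rewrite divr_gt0//= ler_pdivrMr// mul1r => /(_ ltac:(lra)).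
rewrite mulrAC ler_pdivlMr//; nra.
Qed.

(* [z] minimises the squared distance from [|mu| comb z] to [mu] on the finite
   set [s]; the variational inequality in the directions [ev w] and [- ev w]
   forces that distance to vanish. *)
Lemma finite_dual_decomposition (mu : dual (aff_space cS))
    (s : seq (aff_space cS)) :
  exists2 z, 0 <= z.1 <= 1 & forall f, f \in s -> `|mu| * comb z f = mu f.
Proof.
pose K := `[(0 : R), 1]%classic `*` ([set: S] `*` [set: S]).
have cK : compact K.
  apply: compact_setX; first exact: segment_compact.
  by apply: compact_setX; exact: compact_set_type.
have [s0 Ss0] := S_nonempty; pose x0 : S := SigSub (mem_set Ss0).
have K0 : K !=set0.
  by exists (0, (x0, x0)); split => //=; rewrite in_itv /= lexx ler01.
pose Phi z := \sum_(f <- s) (mu f - `|mu| * comb z f) ^+ 2.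
have cPhi : continuous Phi.
  rewrite /Phi => z; apply: cvg_big => [|f _].
  - exact: add_continuous.
  - have cc : (fun u => mu f - `|mu| * comb u f) @ z -->
        mu f - `|mu| * comb z f.
      apply: cvgB; first exact: cvg_cst.
      by apply: cvgM; [exact: cvg_cst|exact: comb_continuous].
    exact: cvgM.
have [[t [x y]] /set_mem[/= t01 _] zmin] :=
  compact_EVT_min K0 cK (continuous_subspaceT cPhi).
rewrite in_itv /= in t01.
pose z0 := (t, (x, y)); pose d f := mu f - `|mu| * comb z0 f.
(* The residual, seen as an element of [A(S)]: evaluating functionals at [F] gives the directional
   derivatives of [Phi], up to a factor. *)
pose F := \sum_(f <- s) d f *: f.
have var (nu : dual (aff_space cS)) : (forall e : R, 0 < e <= 1 ->
    exists2 z, 0 <= z.1 <= 1 & comb z = (1 - e) *: comb z0 + e *: nu) ->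
  `|mu| * nu F <= `|mu| * comb z0 F.
  move=> dir; rewrite -subr_le0 -mulrBr.
  apply: (@small_quadratic _
    (`|mu| ^+ 2 * \sum_(f <- s) (nu f - comb z0 f) ^+ 2)).
    by rewrite mulr_ge0 ?sqr_ge0 ?sumr_ge0// => f _; exact: sqr_ge0.
  move=> e e01; have [z z01 zE] := dir e e01.
  have : Phi z0 <= Phi z.
    apply: zmin; apply/mem_set; split; last by [].
    by rewrite /= in_itv.
  pose v f := nu f - comb z0 f.
  have dv : nu F - comb z0 F = \sum_(f <- s) d f * v f.
    by rewrite /F !dual_sum -sumrB; apply: eq_bigr => f _; rewrite -mulrBr.
  have -> : Phi z = Phi z0 - 2 * `|mu| * e * \sum_(f <- s) d f * v f +
      e ^+ 2 * (`|mu| ^+ 2 * \sum_(f <- s) v f ^+ 2).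
    rewrite !mulr_sumr -sumrB -big_split; apply: eq_bigr => f _.
    rewrite zE /d /v.
    have -> : ((1 - e) *: comb z0 + e *: nu : dual _) f =
       (1 - e) * comb z0 f + e * nu f by [].
    have alg (N a b c : R) : (a - N * ((1 - e) * b + e * c)) ^+ 2 =
        (a - N * b) ^+ 2 - 2 * N * e * ((a - N * b) * (c - b)) +
        e ^+ 2 * (N ^+ 2 * (c - b) ^+ 2) by ring.
    exact: alg.
  rewrite dv; set A := \sum_(f <- s) _; set B := `|mu| ^+ 2 * _.
  have B0 : 0 <= B.
    by rewrite mulr_ge0 ?sqr_ge0 ?sumr_ge0// => f _; exact: sqr_ge0.
  have /andP[e0 _] := e01 => AB.
  have : e * (2 * `|mu| * A) <= e * (e * B) by lra.
  by rewrite ler_pM2l//; nra.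
exists z0 => // f fs.
have nF : `|mu| * `|F| <= `|mu| * comb z0 F.
  have [->|N0] := eqVneq `|mu| 0; first by rewrite !mul0r.
  have {}N0 : 0 < `|mu| by rewrite lt_def N0 normr_ge0.
  have Fw w : `|F w| <= comb z0 F.
    rewrite ler_norml -lerNl; apply/andP; split; rewrite -(ler_pM2l N0).
      (* Negation swaps the two points and replaces [t] by [1 - t], so this direction reduces to the
         direction [ev w]. *)
      have := @var (- ev w); apply => e e01.
      have [|[u [v1 v2]] /= u01 uE] := @comb_convex (1 - t) y x w e _ e01.
        by lra.
      exists (1 - u, (v2, v1)); first by rewrite /=; lra.
      by rewrite combN uE combN opprD !scalerN opprK.
    have := @var (ev w); apply => e e01; exact: comb_convex.
  rewrite ler_pM2l//; apply: sup_abs_le => //.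
  exact: le_trans (Fw x0).
have : mu F <= `|mu| * comb z0 F.
  by apply: le_trans nF; apply: le_trans (ler_norm _) (dual_le _ _).
rewrite -subr_le0.
have -> : mu F - `|mu| * comb z0 F = \sum_(f <- s) d f ^+ 2.
  rewrite /F !dual_sum mulr_sumr -sumrB; apply: eq_bigr => g _.
  by rewrite /d; ring.
move=> d0; have {}d0 : \sum_(f <- s) d f ^+ 2 == 0.
  by rewrite eq_le d0 sumr_ge0// => g _; exact: sqr_ge0.
move: d0; rewrite psumr_eq0; last by move=> g _; exact: sqr_ge0.
by move=> /allP /(_ f fs) /=; rewrite sqrf_eq0 subr_eq0 => /eqP.
Qed.

(** The parameters that are right at a given [f] form a closed set, and finitely many of these sets
    meet; compactness gives parameters valid for all [f]. *)
Lemma dual_decomposition (mu : dual (aff_space cS)) :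
  exists t x y, 0 <= t <= 1 /\ mu = `|mu| *: (t *: ev x - (1 - t) *: ev y).
Proof.
have cK : compact (`[(0 : R), 1]%classic `*` ([set: S] `*` [set: S])).
  apply: compact_setX; first exact: segment_compact.
  by apply: compact_setX; exact: compact_set_type.
have [||[t [x y]] [/= t01 _] tE] := @compact_finite_intersection _ _ _
  [set: aff_space cS] (fun f => [set z | `|mu| * comb z f = mu f]) cK.
- move=> f _; apply: preimage_closed (@closed_eq _ (mu f)) => z _.
  apply: cvgM; [exact: cvg_cst|exact: comb_continuous].
- move=> s _; have [z z01 zs] := finite_dual_decomposition mu s.
  by exists z => // f /zs.
exists t, x, y; split; first by rewrite in_itv in t01.
by apply/val_inj/funext => f; rewrite -[LHS](tE f I).
Qed.

End state_space.

(** * The weight of a point at a split extreme point *)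

Section barycentric_weight.
Context {R : realType} {E : lmodType R}.
Variables (S : set E) (p : E).
Hypothesis p_split : split_face S [set p].
Implicit Types (x y q : E) (a b t : R).

Let C := complementary_set S [set p].

Lemma extreme_point_face q : extreme_points S q -> face S [set q].
Proof.
move=> [Sq qext]; split; first by move=> _ ->.
  by apply/convex_setP => x y t -> -> _;
    rewrite -scalerDl addrCA subrr addr0 scale1r.
by move=> x y t Sx Sy t01 /(qext x y t Sx Sy t01).
Qed.

Lemma extreme_point_complementary q : extreme_points S q -> q != p -> C q.
Proof.
move=> qext qp; exists [set q] => //; split; first exact: extreme_point_face.
by apply/disj_setPRL => _ -> /= qp'; rewrite qp' eqxx in qp.
Qed.

Lemma complementary_nface q : C q -> q <> p.
Proof.
by move=> [G [_ /disj_setPRL Gp] Gq] qp; apply: (Gp q).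
Qed.

Lemma complementary_sub q : C q -> S q.
Proof. by move=> [G [[GS _ _] _] /GS]. Qed.

(** A face containing the combination would contain [p], whereas the faces that make up [C] avoid
    [p]. *)
Lemma complementary_comb a q : 0 < a < 1 -> C q -> ~ C (a *: p + (1 - a) *: q).
Proof.
move=> a01 Cq [G [[GS _ Gext] /disj_setPRL Gp] Gs].
have Sp : S p by have [[+ _ _] _ _] := p_split; apply.
have [Gp' _] := Gext p q a Sp (complementary_sub Cq) a01 Gs.
exact: (Gp p).
Qed.

(** When [a = 1] the point [q] has coefficient 0 and is left free, so [x = p] is covered even if [C]
    is empty. *)
Definition weight x a :=
  0 <= a <= 1 /\ exists2 q, a = 1 \/ C q & x = a *: p + (1 - a) *: q.

Lemma weight_exists x : S x -> exists a, weight x a.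
Proof.
move=> Sx; have [_ _ split_S] := p_split.
have [->|/eqP xp] := eqVneq x p.
  exists 1; split; first by rewrite ler01 lexx.
  by exists p; [left|rewrite scale1r subrr scale0r addr0].
have [Cx|Cx] := pselect (C x).
  exists 0; split; first by rewrite ler01 lexx.
  by exists x; [right|rewrite scale0r subr0 scale1r add0r].
have [|[[a p'] q] [[/andP[a0 a1] -> Cq xE] _]] := split_S x Sx.
  by move=> [].
exists a; split; first by rewrite !ltW.
by exists q => //; right.
Qed.

(** The cases [a = 1], [a = 0] and [0 < a < 1] correspond to [x = p], [x] in [C], and [x] in
    neither, which exclude each other; in the last one the split face property gives uniqueness. *)
Lemma weight_unique x a b : S x -> weight x a -> weight x b -> a = b.
Proof.
move=> Sx.
have w1 u q : 0 <= u <= 1 -> u = 1 \/ C q -> x = u *: p + (1 - u) *: q ->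
    [\/ u = 1 /\ x = p, u = 0 /\ C x |
      [/\ 0 < u < 1, C q & ~ ([set p] `|` C) x]].
  move=> /andP[u0 u1] uq xE.
  have [u1'|u1'] := eqVneq u 1.
    by apply: Or31; rewrite xE u1' scale1r subrr scale0r addr0.
  have {}uq : C q by case: uq => // u1''; rewrite u1'' eqxx in u1'.
  have [u0'|u0'] := eqVneq u 0.
    by apply: Or32; rewrite xE u0' scale0r subr0 scale1r add0r.
  have u01 : 0 < u < 1 by rewrite !lt_def u0' u0 u1 eq_sym u1'.
  apply: Or33; split=> // -[|]; last by rewrite xE; exact: complementary_comb.
  rewrite /= xE => /eqP; rewrite -subr_eq0 -addrAC -{2}[p]scale1r -scalerBl.
  rewrite -opprB scaleNr addrC -scalerBr scaler_eq0 subr_eq0 subr_eq0 eq_sym.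
  rewrite (negbTE u1') /=.
  by move/eqP; exact: complementary_nface.
move=> [a01 [q aq xq]] [b01 [r br xr]].
have [_ _ split_S] := p_split.
have [[-> xp]|[-> Cx]|[a01' Cq nx]] := w1 a q a01 aq xq;
have [[-> xp']|[-> Cx']|[b01' Cr nx']] := w1 b r b01 br xr => //.
- by have := complementary_nface Cx'.
- by case: nx'; left.
- by have := complementary_nface Cx.
- by case: nx'; right.
- by case: nx; left.
- by case: nx; right.
have [[[c p'] q'] [_ uniq]] := split_S x Sx nx.
have /= [<- _ _] := uniq (a, p, q) (And4 a01' erefl Cq xq).
by have /= [<- _ _] := uniq (b, p, r) (And4 b01' erefl Cr xr).
Qed.

(** After collecting the multiples of [p], the remainder [u q + v r] has mass [1 - c], and its
    normalisation lies in [C] by convexity. *)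
Lemma weight_affine x y a b t : 0 <= t <= 1 -> weight x a -> weight y b ->
  weight (t *: x + (1 - t) *: y) (t * a + (1 - t) * b).
Proof.
move=> /andP[t0 t1] [/andP[a0 a1] [q aq ->]] [/andP[b0 b1] [r br ->]].
have [_ /convex_setP C_convex _] := p_split.
set c := t * a + (1 - t) * b.
have c01 : 0 <= c <= 1 by rewrite /c; nra.
split=> //.
set u := t * (1 - a); set v := (1 - t) * (1 - b).
have u0 : 0 <= u by rewrite mulr_ge0 ?subr_ge0.
have v0 : 0 <= v by rewrite mulr_ge0 ?subr_ge0.
have cuv : 1 - c = u + v by rewrite /c /u /v; ring.
have sumE : t *: (a *: p + (1 - a) *: q) + (1 - t) *: (b *: p + (1 - b) *: r) =
    c *: p + (u *: q + v *: r).
  by rewrite !scalerDr !scalerA addrACA -scalerDl.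
have [cE|c1] := eqVneq c 1.
  exists p; first by left.
  have : u + v = 0 by rewrite -cuv cE subrr.
  move=> /eqP; rewrite paddr_eq0// => /andP[/eqP uE /eqP vE].
  by rewrite sumE uE vE cE subrr !scale0r !addr0.
have uv0 : 0 < u + v by rewrite -cuv subr_gt0 lt_neqAle c1; case/andP: c01.
suff [w Cw wE] : exists2 w, C w & u *: q + v *: r = (u + v) *: w.
  by exists w; [right|rewrite sumE cuv wE].
(* A point with coefficient 0 may lie outside [C], so the other one is then used alone. *)
have [uE|un0] := eqVneq u 0.
  exists r; last by rewrite uE scale0r !add0r.
  case: br => // b1'; move: uv0; rewrite uE /v b1' subrr mulr0 addr0 ltxx //.
have [vE|vn0] := eqVneq v 0.
  exists q; last by rewrite vE scale0r !addr0.
  by case: aq => // a1'; rewrite /u a1' subrr mulr0 eqxx in un0.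
exists (u / (u + v) *: q + (1 - u / (u + v)) *: r).
  apply: C_convex.
  - by case: aq => // a1'; rewrite /u a1' subrr mulr0 eqxx in un0.
  - by case: br => // b1'; rewrite /v b1' subrr mulr0 eqxx in vn0.
  - by rewrite divr_ge0 ?(ltW uv0)//= ler_pdivrMr// mul1r lerDl.
by rewrite scalerDr !scalerA; congr (_ *: _ + _ *: _); field; rewrite gt_eqF.
Qed.

Lemma split_extreme_point_weight :
  exists chi : S -> R, [/\ forall x : S, 0 <= chi x <= 1,
    forall (x y z : S) t, 0 <= t <= 1 ->
      val z = t *: val x + (1 - t) *: val y ->
      chi z = t * chi x + (1 - t) * chi y,
    forall x : S, val x = p -> chi x = 1 &
    forall x : S, extreme_points S (val x) -> val x != p -> chi x = 0].
Proof.
have /choice[chi chiP] (x : S) : exists a, weight (val x) a.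
  by apply: weight_exists; exact: set_valP.
exists chi; split.
- by move=> x; have [] := chiP x.
- move=> x y z t t01 zE; apply: (weight_unique (set_valP z)); first exact: chiP.
  by rewrite zE; exact: weight_affine.
- move=> x xp; apply: (weight_unique (set_valP x)); first exact: chiP.
  split; first by rewrite ler01 lexx.
  by exists p; [left|rewrite scale1r subrr scale0r addr0].
- move=> x xext xp; apply: (weight_unique (set_valP x)); first exact: chiP.
  split; first by rewrite ler01 lexx.
  exists (val x); last by rewrite scale0r subr0 scale1r add0r.
  by right; exact: extreme_point_complementary.
Qed.

End barycentric_weight.

(** * From a bounded affine function on [S] to an element of [A(S)**] *)

Section bidual_of_affine.
Context {R : realType} {E : tvsType R} {S : set E} (cS : compact S).
Hypotheses (hausdorffE : hausdorff_space E) (S_convex : convex_set S)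
  (S_nonempty : S !=set0).
Variable chi : S -> R.
Hypothesis chi01 : forall x : S, 0 <= chi x <= 1.
Hypothesis chi_affine : forall (x y z : S) t, 0 <= t <= 1 ->
  val z = t *: val x + (1 - t) *: val y -> chi z = t * chi x + (1 - t) * chi y.
Local Notation ev := (ev cS).

Lemma cone_comb (x y : S) (a b : R) : 0 <= a -> 0 <= b ->
  exists2 z : S, a *: ev x + b *: ev y = (a + b) *: ev z &
    a * chi x + b * chi y = (a + b) * chi z.
Proof.
move=> a0 b0; have [ab0|ab0] := eqVneq (a + b) 0.
  move: (ab0) => /eqP; rewrite paddr_eq0// => /andP[/eqP -> /eqP ->].
  by exists x; rewrite ?scale0r ?mul0r ?addr0 ?scale0r ?mul0r.
have abp : 0 < a + b by rewrite lt_def ab0 addr_ge0.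
have [z zE] := convex_comb x y S_convex a0 b0 abp.
have t01 : 0 <= a / (a + b) <= 1.
  by rewrite divr_ge0 ?(ltW abp)//= ler_pdivrMr// mul1r lerDl.
have alg (c d : R) : a * c + b * d =
    (a + b) * (a / (a + b) * c + (1 - a / (a + b)) * d) by field.
exists z; last by rewrite (chi_affine t01 zE) -alg.
apply/val_inj/funext => f.
transitivity ((a + b) * f z); last by [].
by rewrite (aff_affine _ t01 zE) -alg.
Qed.

(** A list is a formal linear combination of points: [ev_sum] is the functional it represents,
    [chi_sum] the value that a linear extension of [chi] must take there. *)
Definition ev_sum (s : seq (R * S)) := \sum_(i <- s) i.1 *: ev i.2.
Definition chi_sum (s : seq (R * S)) := \sum_(i <- s) i.1 * chi i.2.

(** Each new term is absorbed into the positive or the negative part, according to the sign of its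
    coefficient. *)
Lemma sum_normal_form s : exists a b (x y : S), [/\ 0 <= a, 0 <= b,
  ev_sum s = a *: ev x - b *: ev y & chi_sum s = a * chi x - b * chi y].
Proof.
have [s0 Ss0] := S_nonempty; pose x0 : S := SigSub (mem_set Ss0).
elim: s => [|[c w] s [a [b [x [y [a0 b0 evE chiE]]]]]].
  exists 0, 0, x0, x0.
  by rewrite /ev_sum /chi_sum !big_nil !scale0r !mul0r !subr0.
rewrite /ev_sum /chi_sum !big_cons -/(ev_sum s) -/(chi_sum s) evE chiE /=.
have [c0|/ltW c0] := leP 0 c.
  have [z zE chiz] := cone_comb w x c0 a0.
  exists (c + a), b, z, y; split=> //; first exact: addr_ge0.
    by rewrite addrA zE.
  by rewrite addrA chiz.
have [|z zE chiz] := @cone_comb w y (- c) b _ b0; first by rewrite oppr_ge0.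
exists a, (- c + b), x, z; split=> //; first by rewrite addr_ge0 ?oppr_ge0.
  by rewrite -zE scaleNr opprD opprK addrCA.
by rewrite -chiz; ring.
Qed.

Lemma one_affine : (fun _ : S => 1 : R^o) \in @affine_continuous R E S.
Proof.
rewrite inE; split; first exact: (@cst_continuous S R^o 1).
by move=> x y z t _ _; rewrite !mulr1 addrC subrK.
Qed.

(* Evaluating at the constant function 1 equates the masses of the positive and
   negative parts, and then [A(S)] separates their barycentres. *)
Lemma chi_sum0 s : ev_sum s = 0 -> chi_sum s = 0.
Proof.
have [a [b [x [y [a0 b0 -> ->]]]]] := sum_normal_form s.
move=> evE; have eqf (f : aff_space cS) : a * f x - b * f y = 0.
  exact: (congr1 (fun nu : dual (aff_space cS) => nu f) evE).
have := eqf (AffSpace cS one_affine); rewrite /= !mulr1 => /subr0_eq ab.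
rewrite -{}ab in eqf *.
have [->|an0] := eqVneq a 0; first by rewrite !mul0r subr0.
suff -> : x = y by rewrite subrr.
apply: (@aff_separates _ _ _ cS hausdorffE) => f.
have := eqf f; rewrite -mulrBr => /eqP.
by rewrite mulf_eq0 (negbTE an0) subr_eq0 => /eqP.
Qed.

Lemma affine_bidual : exists F : dual (dual (aff_space cS)),
  forall x : S, F (ev x) = chi x.
Proof.
have dec (mu : dual (aff_space cS)) : exists u : R * S * S,
    0 <= u.1.1 <= 1 /\
    mu = `|mu| *: (u.1.1 *: ev u.1.2 - (1 - u.1.1) *: ev u.2).
  have [t [x [y txy]]] := dual_decomposition S_convex S_nonempty mu.
  by exists (t, x, y).
have /choice[pick pickP] := dec.
pose terms mu : seq (R * S) := [:: (`|mu| * (pick mu).1.1, (pick mu).1.2);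
  (- (`|mu| * (1 - (pick mu).1.1)), (pick mu).2)].
have ev_terms mu : ev_sum (terms mu) = mu.
  rewrite [RHS](proj2 (pickP mu)) /ev_sum /= !big_cons big_nil /= addr0.
  by rewrite scaleNr scalerBr !scalerA.
pose F mu : R^o := chi_sum (terms mu).
have evZ k s : ev_sum [seq (k * i.1, i.2) | i <- s] = k *: ev_sum s.
  rewrite /ev_sum big_map scaler_sumr; apply: eq_bigr => i _.
  by rewrite scalerA.
have chiZ k s : chi_sum [seq (k * i.1, i.2) | i <- s] = k * chi_sum s.
  rewrite /chi_sum big_map mulr_sumr; apply: eq_bigr => i _ /=.
  by rewrite mulrA.
have evD s r : ev_sum (s ++ r) = ev_sum s + ev_sum r by rewrite /ev_sum big_cat.
have chiD s r : chi_sum (s ++ r) = chi_sum s + chi_sum r.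
  by rewrite /chi_sum big_cat.
(* Independence of the representation makes [F] linear, although the representations [terms mu] are
   chosen arbitrarily. *)
have well s r : ev_sum s = ev_sum r -> chi_sum s = chi_sum r.
  move=> sr; apply/eqP; rewrite -subr_eq0 -mulN1r -chiZ -chiD.
  apply/eqP/chi_sum0.
  by rewrite evD evZ sr scaleN1r subrr.
have FB : F \in @bounded_linear R (dual (aff_space cS)).
  rewrite inE; split.
    move=> k mu nu; rewrite /F -[RHS]/(k * _ + _) -chiZ -chiD; apply: well.
    by rewrite evD evZ !ev_terms.
  exists 1 => mu; have [t01 _] := pickP mu.
  rewrite /F /chi_sum /= !big_cons big_nil /= addr0 mulNr -!mulrA -mulrBr.
  rewrite normrM normr_id mul1r ler_piMr// ler_norml.
  have := chi01 (pick mu).1.2; have := chi01 (pick mu).2; nra.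
exists (Dual FB) => x; rewrite /= /F.
have -> : chi x = chi_sum [:: (1, x)].
  by rewrite /chi_sum big_cons big_nil addr0 mul1r.
by apply: well; rewrite ev_terms /ev_sum big_cons big_nil addr0 scale1r.
Qed.

End bidual_of_affine.

(** * Ultrafilter limits and norm-preserving extensions *)

Lemma ultrafilter_cvg_compact (I : Type) (T : topologicalType)
    (U : set_system I) (K : set T) (u : I -> T) :
  UltraFilter U -> compact K -> (forall i, K (u i)) ->
  exists2 l, K l & u i @[i --> U] --> l.
Proof.
move=> UU cK uK.
have [|l [Kl cl]] := cK (u i @[i --> U]) _.
  by apply: (@filterS _ U _ setT) filterT => i _ /=.
exists l => // B Bl; have [//|UB] := in_ultra_setVsetC (u @^-1` B) UU.
by have [y [] ] := cl (~` B) B UB Bl.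
Qed.

Section ultrafilter_limit.
Context {R : realType} {V : normedModType R} {I : Type}.
Variables (U : set_system I) (v : I -> V).

(** Weak-star compactness of the unit ball of the bidual in ultrafilter form: each [f (v i)] stays
    in a compact interval, and the limits depend linearly on [f]. *)
Lemma ultrafilter_weak_limit : UltraFilter U -> (forall i, `|v i| <= 1) ->
  exists2 h : dual (dual V), `|h| <= 1 &
    forall f : dual V, (f (v i) : R) @[i --> U] --> (h f : R).
Proof.
move=> UU v1.
have /choice[h hP] (f : dual V) : exists l : R, `|l| <= `|f| /\
    (f (v i) : R) @[i --> U] --> l.
  have [||l /= lf ul] := @ultrafilter_cvg_compact _ _ U
      `[- `|f|, `|f|]%classic (fun i => f (v i) : R) UU.
  - exact: segment_compact.
  - move=> i /=; rewrite in_itv /= -ler_norml.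
    by apply: le_trans (dual_le _ _) _; rewrite ler_piMr.
  by exists l; rewrite in_itv /= -ler_norml in lf.
have hB : (h : dual V -> R^o) \in @bounded_linear R (dual V).
  rewrite inE; split; last by exists 1 => f; rewrite mul1r; case: (hP f).
  move=> k f g.
  have [_ hf] := hP f; have [_ hg] := hP g; have [_ hkfg] := hP (k *: f + g).
  apply: (cvg_unique (@Rhausdorff R) hkfg).
  by apply: cvgD => //; apply: cvgM => //; exact: cvg_cst.
exists (Dual hB); last by move=> f; case: (hP f).
by apply: sup_abs_le => // f f1; apply: le_trans f1; case: (hP f).
Qed.

End ultrafilter_limit.

Lemma bidual_embed_norm_le (R : realType) (V : normedModType R) (v : V) :
  `|bidual_embed v| <= `|v|.
Proof.
apply: sup_abs_le => // f /= f1; apply: le_trans (dual_le _ _) _.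
by rewrite ler_piMl.
Qed.

Lemma extension_norm_ge (R : realType) (X : normedModType R)
    (Y : submodClosed X) (g : dual (subspace_of Y)) (h : dual X) :
  (forall y : subspace_of Y, h (val y) = g y) -> `|g| <= `|h|.
Proof.
move=> hg; apply: sup_abs_le => // y /= y1; rewrite -hg.
by apply: le_trans (dual_le _ _) _; rewrite ler_piMr.
Qed.

Section restriction.
Context {R : realType} {X : normedModType R} (Y : submodClosed X) (h : dual X).

Lemma restriction_bounded_linear :
  (fun y : subspace_of Y => h (val y)) \in @bounded_linear R (subspace_of Y).
Proof.
rewrite inE; split; first by move=> k y z; rewrite -linearP.
by exists `|h| => y; exact: dual_le.
Qed.

Definition restriction : dual (subspace_of Y) :=
  Dual restriction_bounded_linear.

End restriction.

(** The traces of the neighbourhoods of [p] on [A] without [p] generate a proper filter exactly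
    because [p] is a limit point; any finer ultrafilter will do. *)
Lemma limit_point_ultrafilter (T : topologicalType) (S A : set T) (p : S) :
  A `<=` S -> limit_point A (val p) ->
  exists U : set_system S, [/\ UltraFilter U, U --> p &
    U [set q | A (val q) /\ val q != val p]].
Proof.
move=> AS Ap.
pose W := within [set q : S | A (val q) /\ val q != val p] (nbhs p).
have WP : ProperFilter W.
  apply: Build_ProperFilter_ex => B [_ [[G oG <-] /= Gp] GB].
  have [y [yp Ay Gy]] := Ap G (open_nbhs_nbhs (conj oG Gp)).
  exists (SigSub (mem_set (AS y Ay))); exact: GB.
have [U [UU WU]] := ultraFilterLemma WP.
exists U; split=> //.
  by move=> B pB; apply: WU; apply: filterS pB => q.
by apply: WU; rewrite /W /within /=; apply: filterE.
Qed.

(** * Two extensions of one norm-attaining functional *)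

Theorem proposition6p6 (R : realType) (E : tvsType R) (S : set E)
  (hausdorffE : hausdorff_space E)
  (S_nonempty : S !=set0) (cS : compact S) (S_convex : convex_set S)
  (ext_limit : forall p : E, extreme_points S p ->
     limit_point (extreme_points S) p)
  (ext_split : forall p : E, extreme_points S p -> split_face S [set p])
  (Y : submodClosed (aff_space cS))
  (Y_nonzero : exists2 f : aff_space cS, f \in Y & f != 0) :
  ~ property_wU (image_subspace (bidual_embed (V := aff_space cS)) Y).
Proof.
have [f fY f0] := Y_nonzero.
have [p p_ext fp] := aff_norm_extreme_point hausdorffE f S_nonempty.
have [chi [chi01 chi_affine chi1 chi0]] :=
  split_extreme_point_weight (ext_split _ p_ext).
have [F Fchi] :=
  affine_bidual cS hausdorffE S_convex S_nonempty chi01 chi_affine.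
have [|U [UU Up Uext]] := limit_point_ultrafilter _ (ext_limit _ p_ext).
  by move=> q [].
have [h h1 hU] := ultrafilter_weak_limit UU (ev_norm cS).
pose e := bidual_embed (ev cS p).
have e1 : `|e| <= 1 := le_trans (bidual_embed_norm_le _) (ev_norm cS p).
(* Continuity of [k] gives [k q --> k p] along [U], so [h] and [e] agree on the canonical image of
   [A(S)]. *)
have he (k : aff_space cS) : h (bidual_embed k) = e (bidual_embed k).
  apply: (cvg_unique (@Rhausdorff R) (hU _)).
  have kU : (k q : R^o) @[q --> U] --> k p.
    exact: cvg_trans (cvg_app _ Up) (aff_continuous (x := p)).
  exact: kU.
(* [U] is carried by the extreme points other than [p], where [chi] vanishes. *)
have hF : h F = 0.
  apply: (cvg_unique (@Rhausdorff R) (hU _)).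
  apply: cvg_near_cst; apply: filterS Uext => q [qext qp].
  by rewrite Fchi chi0.
set YY := image_subspace _ _.
pose g := restriction YY e.
have g_ext (k : dual (dual (dual (aff_space cS)))) :
    (forall a, k (bidual_embed a) = e (bidual_embed a)) ->
    forall y : subspace_of YY, k (val y) = g y.
  move=> ke y; have /set_mem[a _ aE] : val y \in YY := valP y.
  by rewrite [RHS]/(e (val y)) -aE ke.
have f_gt0 : 0 < `|f| by rewrite normr_gt0.
(* The normalised [f] is where [g] attains its norm, since [|f p| = |f|]. *)
have y0P : bidual_embed (`|f|^-1 *: f) \in YY.
  by rewrite inE; exists (`|f|^-1 *: f) => //; exact: rpredZ.
pose y0 := SubspaceOf y0P.
have y01 : `|y0| <= 1.
  apply: le_trans (bidual_embed_norm_le _) _.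
  by rewrite normrZ ger0_norm ?invr_ge0// mulVf ?gt_eqF.
have gy0 : `|g y0| = 1.
  have -> : g y0 = `|f|^-1 * f p by [].
  by rewrite normrM fp ger0_norm ?invr_ge0// mulVf ?gt_eqF.
have g1 : `|g| = 1.
  apply/le_anti/andP; split.
    exact: le_trans (extension_norm_ge (g_ext e _)) e1.
  by rewrite -gy0; apply: le_trans (dual_le _ _) _; rewrite ler_piMr.
have norm1 (k : dual (dual (dual (aff_space cS)))) :
    (forall y : subspace_of YY, k (val y) = g y) -> `|k| <= 1 -> `|k| = `|g|.
  by move=> kg k1; apply/le_anti; rewrite (extension_norm_ge kg) g1 k1.
move=> /(_ g) [|k [_ kuniq]]; first by exists y0; rewrite ?gy0.
have ke : k = e.
  by apply: kuniq; split; [exact: g_ext|exact: norm1 (g_ext _ _) e1].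
have kh : k = h.
  by apply: kuniq; split; [exact: g_ext|exact: norm1 (g_ext _ _) h1].
have : e F = h F by rewrite -ke kh.
by rewrite hF /= Fchi chi1// => /eqP; rewrite oner_eq0.
Qed.
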